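(* Suppose that $(X^{(n)})_{n\in\mathbb{N}_0}$ is a sequence of product measurable processes with values in $[0,\infty]$ such that $$\mathbb{E}\big[(X_t^{(n)})^p\big]^{\frac1p}\le v(t)+\bigg(\int_{[0,t]}l(t,s)^\beta\mathbb{E}\big[(X_s^{(n-1)})^p\big]^{\frac\beta p}\,\mu(\mathrm{d}s)\bigg)^{\frac1\beta}$$ for all $n\in\mathbb{N}$ and $t\in J$. Then $$\bigg(\int_{[0,t]}\mathbb{E}\big[(X_s^{(n)})^p\big]\,\mu(\mathrm{d}s)\bigg)^{\frac1p}\le\bigg(\int_{[0,t]}v(s)^p\,\mu(\mathrm{d}s)\bigg)^{\frac1p}+\sum_{i=1}^{n-1}\bigg(\int_{[0,t]}l_{\mu,i,\beta,p}(t,s)v(s)^p\,\mu(\mathrm{d}s)\bigg)^{\frac1p}+\bigg(\int_{[0,t]}l_{\mu,n,\beta,p}(t,s)\mathbb{E}\big[(X_s^{(0)})^p\big]\,\mu(\mathrm{d}s)\bigg)^{\frac1p}$$ for any $n\in\mathbb{N}$ and $t\in J$, and equality holds if $\beta=p=1$ and the assumed inequality is an equation, that is, $\mathbb{E}\big[X_t^{(n)}\big]=v(t)+\int_{[0,t]}l(t,s)\mathbb{E}\big[X_s^{(n-1)}\big]\,\mu(\mathrm{d}s)$ for all $n\in\mathbb{N}$ and $t\in J$.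
   Context: $(\Omega,\mathcal{F},\mathbb{P})$ is a probability space, $I$ is a non-degenerate interval in $[0,\infty)$ with $0\in I$, $\mu$ is a $\sigma$-finite Borel measure on $I$ and $J$ is a set in $I$ of full $\mu$-measure. $p\ge1$ and $\beta\in[1,p]$. $Y$ is a $[0,\infty]$-valued product measurable process. A non-negative kernel on $I$ is a $[0,\infty]$-valued measurable function on $\{(t,s)\in I\times I:s\le t\}$; $k$ and $l$ are non-negative kernels on $I$, and $v(t):=\mathbb{E}[Y_t^p]^{1/p}+(\int_{[0,t]}k(t,s)^\beta\,\mu(\mathrm{d}s))^{1/\beta}$ for $t\in I$. The iterated kernels of a non-negative kernel $k$ relative to $\mu$ are $\mathrm{R}_{k,\mu,1}:=k$, $\mathrm{R}_{k,\mu,n+1}(t,s):=\int_{[s,t]}k(t,\tilde s)\mathrm{R}_{k,\mu,n}(\tilde s,s)\,\mu(\mathrm{d}\tilde s)$. For $n\in\mathbb{N}$, $$l_{\mu,n,\beta,p}(t,s):=\int_{[s,t]}\Big(\int_{[0,\tilde s]}\mathrm{R}_{l^\beta,\mu,n}(\tilde s,r)\,\mu(\mathrm{d}r)\Big)^{\frac p\beta-1}\mathrm{R}_{l^\beta,\mu,n}(\tilde s,s)\,\mu(\mathrm{d}\tilde s)\quad\text{if }\beta<p,$$ and $l_{\mu,n,\beta,p}(t,s):=\int_{[s,t]}\mathrm{R}_{l^\beta,\mu,n}(\tilde s,s)\,\mu(\mathrm{d}\tilde s)$ if $\beta=p$. *)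

(* Defs.v *)
From HB Require Import structures.
From mathcomp Require Import all_boot all_order all_algebra.
From mathcomp Require Import all_classical all_reals all_analysis.
From mathcomp Require Import measurable_realfun.
Set Implicit Arguments.
Unset Strict Implicit.
Unset Printing Implicit Defensive.
Import Order.TTheory GRing.Theory Num.Theory.
Import numFieldNormedType.Exports.
Local Open Scope classical_set_scope.
Local Open Scope ring_scope.
Local Open Scope ereal_scope.

(* Functions on I, on I x Omega or on the triangle below are total functions
   whose values outside these sets are irrelevant.  In the same way, a Borel
   measure on I is the restriction to I of a Borel measure on R. *)

Definition triangle (R : realType) (I : set R) : set (R * R) :=
  [set z | I z.1 /\ I z.2 /\ (z.2 <= z.1)%R].

Definition nonneg_kernel (R : realType) (I : set R) (k : R -> R -> \bar R) :=
  measurable_fun (triangle I) (fun z => k z.1 z.2)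
  /\ (forall t s, triangle I (t, s) -> 0 <= k t s).

Definition nonneg_process (R : realType) (d : measure_display)
    (Omega : measurableType d) (I : set R) (X : R -> Omega -> \bar R) :=
  measurable_fun (I `*` [set: Omega]) (fun z => X z.1 z.2)
  /\ (forall t w, I t -> 0 <= X t w).

(* The library's expectation only applies to real-valued functions, so the
   expectation of a [0, +oo]-valued function is written as an integral. *)
Definition moment (R : realType) (d : measure_display)
    (Omega : measurableType d) (P : probability Omega R) (p : R)
    (Z : Omega -> \bar R) : \bar R :=
  \int[P]_w (Z w `^ p).

(* R_{k,mu,n}; only n >= 1 is meaningful, n = 0 is a dummy value. *)
Fixpoint iter_kernel (R : realType)
    (mu : {measure set R -> \bar R})
    (k : R -> R -> \bar R) (n : nat) : R -> R -> \bar R :=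
  match n with
  | 0%N => fun _ _ => 0
  | 1%N => k
  | m.+1 => fun t s =>
      \int[mu]_(u in `[s, t]) (k t u * iter_kernel mu k m u s)
  end.

(* l_{mu,n,beta,p}, for beta <= p *)
Definition power_kernel (R : realType)
    (mu : {measure set R -> \bar R})
    (l : R -> R -> \bar R) (n : nat) (beta p : R) (t s : R) : \bar R :=
  let Rn := iter_kernel mu (fun t' s' => l t' s' `^ beta) n in
  if (beta < p)%R then
    \int[mu]_(u in `[s, t])
      ((\int[mu]_(r in `[0%R, u]) Rn u r) `^ (p / beta - 1)%R * Rn u s)
  else \int[mu]_(u in `[s, t]) Rn u s.

Definition vfun (R : realType) (d : measure_display)
    (Omega : measurableType d) (P : probability Omega R)
    (mu : {measure set R -> \bar R})
    (k : R -> R -> \bar R) (Y : R -> Omega -> \bar R) (beta p : R) (t : R)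
    : \bar R :=
  moment P p (Y t) `^ p^-1
  + (\int[mu]_(s in `[0%R, t]) (k t s `^ beta)) `^ beta^-1.

(* Main.v *)
(* Fix t and let m be the restriction of mu to [0, t], which is sigma-finite. With
   B f := (int l(., s)^beta f(s)^beta m(ds))^(1/beta), the p-th moment norms x_n
   satisfy x_n <= v + B x_(n-1) m-a.e. Minkowski's inequality, in L^beta and then
   in L^p(m), makes f |-> ||B^j f||_p subadditive, so that unrolling the recursion
   gives ||x_n||_p <= sum_(i < n) ||B^i v||_p + ||B^n x_0||_p. By Tonelli B^j f is
   the same integral with l^beta replaced by its j-th iterated kernel, and weighted
   Jensen followed by Tonelli bounds ||B^j f||_p^p by the integral of f^p against
   l_(mu,j,beta,p). For beta = p = 1 every step is an equality. *)
Require Import Defs.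
From HB Require Import structures.
From mathcomp Require Import all_boot all_order all_algebra.
From mathcomp Require Import all_classical all_reals all_analysis.
From mathcomp Require Import measurable_realfun.
Import Order.TTheory GRing.Theory Num.Theory.
Import numFieldNormedType.Exports.
Local Open Scope classical_set_scope.
Local Open Scope ring_scope.
Local Open Scope ereal_scope.

Set Implicit Arguments.
Unset Strict Implicit.

(** * Powers of extended real numbers *)

Section poweR_complements.
Context {R : realType}.
Implicit Types (x y : \bar R) (r : R).

Lemma ge0_le_poweR x y r : (0 <= r)%R -> 0 <= x -> x <= y -> x `^ r <= y `^ r.
Proof.
move=> r0 x0 xy; apply: gt0_ler_poweR => //; rewrite in_itv/= leey andbT//.
exact: le_trans xy.
Qed.

Lemma poweRVK x r : (r != 0)%R -> 0 <= x -> (x `^ r^-1) `^ r = x.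
Proof. by move=> r0 x0; rewrite -poweRrM mulVf// poweRe1. Qed.

Lemma measurable_fun_poweR d (T : measurableType d) (D : set T) (f : T -> \bar R) r :
  measurable_fun D f -> measurable_fun D (fun t => f t `^ r).
Proof. by move=> mf; exact: (measurableT_comp (measurable_poweR r)). Qed.

End poweR_complements.

(** * Minkowski, Hölder and weighted Jensen for [[0, +oo]]-valued functions *)

Section ge0_inequalities.
Context d (T : measurableType d) (R : realType).
Variable mu : {measure set T -> \bar R}.
Implicit Types (f g : T -> \bar R) (p q : R).

(** Passage to real-valued functions: if the integral of the p-th power is finite, [f] is finite
    almost everywhere, so [fine] alters it only on a null set and the real-valued inequalities of
    Minkowski and Hölder become applicable. *)
Lemma Lnorm_fine_ge0 f p : (0 < p)%R -> (forall x, 0 <= f x) ->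
  measurable_fun setT f -> \int[mu]_x (f x `^ p) < +oo ->
  Lnorm mu p%:E (EFin \o fine \o f) = (\int[mu]_x (f x `^ p)) `^ p^-1
  /\ (\forall x \ae mu, f x \is a fin_num).
Proof.
move=> p0 f0 mf foo.
have mfp : measurable_fun setT (fun x => f x `^ p) by exact: measurable_fun_poweR.
have fae : \forall x \ae mu, f x \is a fin_num.
  have /integrable_ae : mu.-integrable setT (fun x => f x `^ p).
    apply/integrableP; split=> //.
    by under eq_integral do rewrite gee0_abs ?poweR_ge0//.
  move=> /(_ measurableT); apply: filterS => x /(_ I).
  rewrite !ge0_fin_numE ?poweR_ge0//.
  by apply: lty_poweRy; rewrite gt_eqF.
split=> //; rewrite unlock; congr (_ `^ _).
apply: ge0_ae_eq_integral => //.
- apply: measurable_fun_poweR; apply: measurableT_comp => //.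
  by apply/measurable_EFinP; exact: measurableT_comp.
- by move=> x _; exact: poweR_ge0.
- by move=> x _; exact: poweR_ge0.
- apply: filterS fae => x fx _.
  by rewrite (_ : (EFin \o fine \o f) x = f x) ?gee0_abs//; exact: fineK.
Qed.

(** An infinite norm on the right makes the bound trivial; otherwise both functions are almost
    everywhere finite. *)
Lemma ge0_minkowski f g p : (1 <= p)%R ->
  measurable_fun setT f -> (forall x, 0 <= f x) ->
  measurable_fun setT g -> (forall x, 0 <= g x) ->
  (\int[mu]_x ((f x + g x) `^ p)) `^ p^-1 <=
  (\int[mu]_x (f x `^ p)) `^ p^-1 + (\int[mu]_x (g x `^ p)) `^ p^-1.
Proof.
move=> p1 mf f0 mg g0; have p0 : (0 < p)%R by rewrite (lt_le_trans _ p1).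
have pV0 : (0 < p^-1)%R by rewrite invr_gt0.
have [foo|] := ltP (\int[mu]_x (f x `^ p)) +oo; last first.
  rewrite leye_eq => /eqP ->.
  by rewrite poweRyr ?gt_eqF// addye ?leey// gt_eqF// (lt_le_trans _ (poweR_ge0 _ _)).
have [goo|] := ltP (\int[mu]_x (g x `^ p)) +oo; last first.
  rewrite leye_eq => /eqP ->.
  by rewrite poweRyr ?gt_eqF// addey ?leey// gt_eqF// (lt_le_trans _ (poweR_ge0 _ _)).
have [<- fae] := Lnorm_fine_ge0 p0 f0 mf foo.
have [<- gae] := Lnorm_fine_ge0 p0 g0 mg goo.
have mff : measurable_fun setT (fine \o f) by exact: measurableT_comp.
have mgg : measurable_fun setT (fine \o g) by exact: measurableT_comp.
apply: le_trans (minkowski_EFin mu mff mgg p1).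
rewrite unlock; apply: ge0_le_poweR; first exact: ltW.
  by apply: integral_ge0 => x _; exact: poweR_ge0.
apply: ae_ge0_le_integral => //.
- by move=> x _; exact: poweR_ge0.
- by apply: measurable_fun_poweR; exact: emeasurable_funD.
- by move=> x _; exact: poweR_ge0.
- apply: measurable_fun_poweR; apply: measurableT_comp => //.
  by apply/measurable_EFinP; exact: measurable_funD.
- apply: filterS2 fae gae => x fx gx _.
  rewrite (_ : (EFin \o _) x = f x + g x) ?gee0_abs ?adde_ge0//.
  by rewrite /= EFinD !fineK.
Qed.

Lemma ge0_integral_eq0_ae f : measurable_fun setT f -> (forall x, 0 <= f x) ->
  \int[mu]_x f x = 0 -> \forall x \ae mu, f x = 0.
Proof.
move=> mf f0 f00.
have : ae_eq mu setT f (cst 0).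
  apply/ae_eq_integral_abs => //.
  by under eq_integral do rewrite gee0_abs//.
by apply: filterS => x; exact.
Qed.

Lemma ge0_ae0_integral f : measurable_fun setT f -> (forall x, 0 <= f x) ->
  (\forall x \ae mu, f x = 0) -> \int[mu]_x f x = 0.
Proof.
move=> mf f0 fae; rewrite -(integral0 mu setT).
by apply: ge0_ae_eq_integral => //; apply: filterS fae => x + _.
Qed.

(** Vanishing norms come first: since [0 * +oo = 0], the right-hand side may be zero although one
    factor is infinite, and then the product [f x * g x] has to vanish almost everywhere. Afterwards
    an infinite factor makes the bound trivial. *)
Lemma ge0_hoelder f g p q : (0 < p)%R -> (0 < q)%R -> (p^-1 + q^-1 = 1)%R ->
  measurable_fun setT f -> (forall x, 0 <= f x) ->
  measurable_fun setT g -> (forall x, 0 <= g x) ->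
  \int[mu]_x (f x * g x) <=
  (\int[mu]_x (f x `^ p)) `^ p^-1 * (\int[mu]_x (g x `^ q)) `^ q^-1.
Proof.
move=> p0 q0 pq mf f0 mg g0.
have pV0 : (0 < p^-1)%R by rewrite invr_gt0.
have qV0 : (0 < q^-1)%R by rewrite invr_gt0.
have mfp : measurable_fun setT (fun x => f x `^ p) by exact: measurable_fun_poweR.
have mgq : measurable_fun setT (fun x => g x `^ q) by exact: measurable_fun_poweR.
have mfg : measurable_fun setT (fun x => f x * g x) by exact: emeasurable_funM.
have if0 : 0 <= \int[mu]_x (f x `^ p).
  by apply: integral_ge0 => x _; exact: poweR_ge0.
have ig0 : 0 <= \int[mu]_x (g x `^ q).
  by apply: integral_ge0 => x _; exact: poweR_ge0.
have [f00|fN0] := eqVneq (\int[mu]_x (f x `^ p)) 0.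
  rewrite f00 poweR0r ?gt_eqF// mul0e ge0_ae0_integral//.
    by move=> x; exact: mule_ge0.
  apply: filterS (ge0_integral_eq0_ae mfp (fun x => poweR_ge0 _ _) f00) => x.
  by move=> /(poweR_eq0_eq0 (f0 x)) ->; rewrite mul0e.
have [g00|gN0] := eqVneq (\int[mu]_x (g x `^ q)) 0.
  rewrite g00 (poweR0r (r := q^-1)) ?gt_eqF// mule0 ge0_ae0_integral//.
    by move=> x; exact: mule_ge0.
  apply: filterS (ge0_integral_eq0_ae mgq (fun x => poweR_ge0 _ _) g00) => x.
  by move=> /(poweR_eq0_eq0 (g0 x)) ->; rewrite mule0.
have [foo|] := ltP (\int[mu]_x (f x `^ p)) +oo; last first.
  rewrite leye_eq => /eqP ->.
  by rewrite poweRyr ?gt_eqF// gt0_mulye ?leey// poweR_gt0// lt0e gN0.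
have [goo|] := ltP (\int[mu]_x (g x `^ q)) +oo; last first.
  rewrite leye_eq => /eqP ->.
  by rewrite (poweRyr (r := q^-1)) ?gt_eqF// gt0_muley ?leey// poweR_gt0// lt0e fN0.
have [<- fae] := Lnorm_fine_ge0 p0 f0 mf foo.
have [<- gae] := Lnorm_fine_ge0 q0 g0 mg goo.
have mff : measurable_fun setT (fine \o f) by exact: measurableT_comp.
have mgg : measurable_fun setT (fine \o g) by exact: measurableT_comp.
apply: le_trans (hoelder mu mff mgg p0 q0 pq).
rewrite Lnorm1; apply: ae_ge0_le_integral => //.
- by move=> x _; exact: mule_ge0.
- apply: measurableT_comp => //.
  by apply/measurable_EFinP; exact: measurable_funM.
- apply: filterS2 fae gae => x fx gx _.
  rewrite (_ : (EFin \o _) x = f x * g x) ?gee0_abs ?mule_ge0//.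
  by rewrite /= EFinM !fineK.
Qed.

(* For [r > 1] this is Hoelder's inequality applied to
   [k * f = k^(1 - 1/r) * (k^(1/r) * f)]. *)
Lemma ge0_weighted_jensen k f r : (1 <= r)%R ->
  measurable_fun setT k -> (forall x, 0 <= k x) ->
  measurable_fun setT f -> (forall x, 0 <= f x) ->
  (\int[mu]_x (k x * f x)) `^ r <=
  (\int[mu]_x k x) `^ (r - 1) * \int[mu]_x (k x * f x `^ r).
Proof.
rewrite le_eqVlt => /predU1P[<-|r1] mk k0 mf f0.
  rewrite subrr poweRe0 mul1e poweRe1; last first.
    by apply: integral_ge0 => x _; exact: mule_ge0.
  by under [leRHS]eq_integral do rewrite poweRe1//.
have r0 : (0 < r)%R by rewrite (lt_trans _ r1).
have rV1 : (0 < 1 - r^-1)%R by rewrite subr_gt0 invf_lt1.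
pose q := ((1 - r^-1)^-1)%R.
have q0 : (0 < q)%R by rewrite invr_gt0.
have qr : (q^-1 + r^-1 = 1)%R by rewrite invrK subrK.
have := @ge0_hoelder (fun x => k x `^ q^-1) (fun x => k x `^ r^-1 * f x) q r q0 r0 qr.
have -> : \int[mu]_x (k x `^ q^-1 * (k x `^ r^-1 * f x)) = \int[mu]_x (k x * f x).
  apply: eq_integral => x _; rewrite muleA -poweRD.
    by rewrite qr poweRe1.
  by apply: add_neq0_poweRD_def; rewrite qr.
under [X in _ -> _ -> _ -> _ -> _ <= X `^ _ * _]eq_integral do
  rewrite poweRVK ?gt_eqF//.
under [X in _ -> _ -> _ -> _ -> _ <= _ * X `^ _]eq_integral do
  rewrite poweRM ?poweR_ge0// poweRVK ?gt_eqF//.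
move=> H.
have {}H := H (measurable_fun_poweR _ mk) (fun x => poweR_ge0 _ _)
  (emeasurable_funM (measurable_fun_poweR _ mk) mf)
  (fun x => mule_ge0 (poweR_ge0 _ _) (f0 x)).
have ikf0 : 0 <= \int[mu]_x (k x * f x) by apply: integral_ge0 => x _; exact: mule_ge0.
apply: le_trans (ge0_le_poweR (ltW r0) ikf0 H) _.
rewrite poweRM ?poweR_ge0// -!poweRrM mulVf ?gt_eqF// invrK mulrBl mul1r mulVf ?gt_eqF//.
rewrite poweRe1//; apply: integral_ge0 => x _; apply: mule_ge0 => //.
exact: poweR_ge0.
Qed.

End ge0_inequalities.

(** * Integral operators with non-negative kernels and their powers *)

Section kernel_operators.
Context d (T : measurableType d) (R : realType).
Variable m : {sigma_finite_measure set T -> \bar R}.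
Implicit Types (K L : T -> T -> \bar R) (f g : T -> \bar R).

Definition jointly_measurable K := measurable_fun [set: T * T] (fun z => K z.1 z.2).

Definition kernel_op K f (u : T) := \int[m]_s (K u s * f s).

(* The index is shifted: [kernel_pow L n] is the iterated kernel of order n + 1. *)
Fixpoint kernel_pow L (n : nat) : T -> T -> \bar R :=
  if n is n'.+1 then fun u s => \int[m]_w (L u w * kernel_pow L n' w s) else L.

Lemma kernel_op_ge0 K f u : (forall u s, 0 <= K u s) -> (forall s, 0 <= f s) ->
  0 <= kernel_op K f u.
Proof. by move=> K0 f0; apply: integral_ge0 => s _; exact: mule_ge0. Qed.

Lemma measurable_kernelr K u : jointly_measurable K -> measurable_fun setT (K u).
Proof. by move=> mK; exact: (measurable_fun_pair2 u mK). Qed.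

Lemma measurable_kernell K s : jointly_measurable K -> measurable_fun setT (K ^~ s).
Proof. by move=> mK; exact: (measurable_fun_pair1 s mK). Qed.

Lemma measurable_kernel_op K f : jointly_measurable K -> (forall u s, 0 <= K u s) ->
  measurable_fun setT f -> (forall s, 0 <= f s) ->
  measurable_fun setT (kernel_op K f).
Proof.
move=> mK K0 mf f0.
apply: (measurable_fun_fubini_tonelli_F (fun z => K z.1 z.2 * f z.2)).
  apply: emeasurable_funM => //.
  exact: (measurableT_comp mf measurable_snd).
by move=> z; exact: mule_ge0.
Qed.

Lemma measurable_kernel_comp K L : jointly_measurable K -> (forall u s, 0 <= K u s) ->
  jointly_measurable L -> (forall u s, 0 <= L u s) ->
  jointly_measurable (fun u s => \int[m]_w (L u w * K w s)).
Proof.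
move=> mK K0 mL L0.
apply: (measurable_fun_fubini_tonelli_F
  (fun z : (T * T) * T => L z.1.1 z.2 * K z.2 z.1.2)).
  apply: emeasurable_funM.
    apply: (measurableT_comp mL (g := fun z : (T * T) * T => (z.1.1, z.2))).
    by apply: measurable_fun_pair => //; exact: measurableT_comp.
  apply: (measurableT_comp mK (g := fun z : (T * T) * T => (z.2, z.1.2))).
  by apply: measurable_fun_pair => //; exact: measurableT_comp.
by move=> z; exact: mule_ge0.
Qed.

Lemma kernel_pow_ge0 L n u s : (forall u s, 0 <= L u s) -> 0 <= kernel_pow L n u s.
Proof.
move=> L0; elim: n u s => //= n IH u s.
by apply: integral_ge0 => w _; exact: mule_ge0.
Qed.

Lemma measurable_kernel_pow L n : jointly_measurable L -> (forall u s, 0 <= L u s) ->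
  jointly_measurable (kernel_pow L n).
Proof.
move=> mL L0; elim: n => //= n IH; apply: measurable_kernel_comp => //.
by move=> *; exact: kernel_pow_ge0.
Qed.

(** Tonelli moves the operator from [f] onto [c]. With [c := L u] this composes kernels; with a
    weight as [c] it yields an integral of [f] against a marginal kernel. *)
Lemma integral_kernel_op K c f : jointly_measurable K -> (forall u s, 0 <= K u s) ->
  measurable_fun setT c -> (forall u, 0 <= c u) ->
  measurable_fun setT f -> (forall s, 0 <= f s) ->
  \int[m]_u (c u * kernel_op K f u) = \int[m]_s ((\int[m]_u (c u * K u s)) * f s).
Proof.
move=> mK K0 mc c0 mf f0.
pose F (z : T * T) := c z.1 * (K z.1 z.2 * f z.2).
have mF : measurable_fun setT F.
  apply: emeasurable_funM; first exact: (measurableT_comp mc measurable_fst).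
  by apply: emeasurable_funM => //; exact: (measurableT_comp mf measurable_snd).
have F0 z : 0 <= F z by apply: mule_ge0 => //; exact: mule_ge0.
transitivity (\int[m]_u \int[m]_s F (u, s)).
  apply: eq_integral => u _; rewrite -ge0_integralZl//.
    by apply: emeasurable_funM => //; exact: measurable_kernelr.
  by move=> s _; exact: mule_ge0.
rewrite fubini_tonelli//; apply: eq_integral => s _.
rewrite muleC -ge0_integralZl//.
- by apply: eq_integral => u _; rewrite /F/= [RHS]muleC muleA.
- by apply: emeasurable_funM => //; exact: measurable_kernell.
- by move=> u _; exact: mule_ge0.
Qed.

Lemma kernel_op_powS L n f : jointly_measurable L -> (forall u s, 0 <= L u s) ->
  measurable_fun setT f -> (forall s, 0 <= f s) ->
  kernel_op (kernel_pow L n.+1) f = kernel_op L (kernel_op (kernel_pow L n) f).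
Proof.
move=> mL L0 mf f0; apply/funext => u; rewrite [RHS]integral_kernel_op//.
- exact: measurable_kernel_pow.
- by move=> *; exact: kernel_pow_ge0.
- exact: measurable_kernelr.
Qed.

(** [kernel_pow] adds each new factor on the left, whereas unrolling the recursion applies [L] to
    the innermost function first; powers of [L] commute with [L]. *)
Lemma kernel_op_powSr L n f : jointly_measurable L -> (forall u s, 0 <= L u s) ->
  measurable_fun setT f -> (forall s, 0 <= f s) ->
  kernel_op (kernel_pow L n.+1) f = kernel_op (kernel_pow L n) (kernel_op L f).
Proof.
move=> mL L0 mf f0; elim: n => [|n IH]; first exact: kernel_op_powS.
rewrite kernel_op_powS// IH kernel_op_powS//; first exact: measurable_kernel_op.
by move=> s; exact: kernel_op_ge0.
Qed.

(** Multiplying each function by [K u s] to the power [b^-1] absorbs the kernel; what remains is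
    Minkowski in L^b(m). *)
Lemma kernel_op_minkowski K f g (b : R) u : (1 <= b)%R ->
  jointly_measurable K -> (forall u s, 0 <= K u s) ->
  measurable_fun setT f -> (forall s, 0 <= f s) ->
  measurable_fun setT g -> (forall s, 0 <= g s) ->
  kernel_op K (fun s => (f s + g s) `^ b) u `^ b^-1 <=
  kernel_op K (fun s => f s `^ b) u `^ b^-1 + kernel_op K (fun s => g s `^ b) u `^ b^-1.
Proof.
move=> b1 mK K0 mf f0 mg g0; have b0 : (b != 0)%R by rewrite gt_eqF// (lt_le_trans _ b1).
have E (h : T -> \bar R) : (forall s, 0 <= h s) ->
    kernel_op K (fun s => h s `^ b) u = \int[m]_s ((K u s `^ b^-1 * h s) `^ b).
  move=> h0; apply: eq_integral => s _.
  by rewrite poweRM ?poweR_ge0// poweRVK.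
rewrite !E//; last by move=> s; exact: adde_ge0.
have mKb : measurable_fun setT (fun s => K u s `^ b^-1).
  by apply: measurable_fun_poweR; exact: measurable_kernelr.
under eq_integral do rewrite ge0_muleDr//.
apply: ge0_minkowski => //.
- exact: emeasurable_funM.
- by move=> s; rewrite mule_ge0 ?poweR_ge0.
- exact: emeasurable_funM.
- by move=> s; rewrite mule_ge0 ?poweR_ge0.
Qed.

End kernel_operators.

(** * Unrolling the recursive inequality in L^p(m) *)

Section iterated_inequality.
Context d (T : measurableType d) (R : realType).
Variable m : {sigma_finite_measure set T -> \bar R}.
Variables (L : T -> T -> \bar R) (p b : R).
Hypothesis mL : jointly_measurable L.
Hypothesis L0 : forall u s, 0 <= L u s.
Hypothesis b1 : (1 <= b)%R.
Hypothesis bp : (b <= p)%R.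
Implicit Types f g v : T -> \bar R.

Let Lpow := kernel_pow m L.
Let Lop n f := kernel_op m (Lpow n) (fun s => f s `^ b).

(* The L^p-norm of the j-th iterate of [f |-> (\int L(., s) f(s)^b ds)^(1/b)]. *)
Definition iter_Lnorm (j : nat) f : \bar R :=
  (if j is j'.+1 then \int[m]_u (Lop j' f u `^ (p / b)) else \int[m]_u (f u `^ p))
    `^ p^-1.

(** With [m] the restriction of [mu] to [[0, t]] and [L] the zero extension of [l^beta], this is
    l_{mu,n+1,beta,p}(t, s) for [s] in [[0, t]]; the time [t] enters only through [m] and [L]. *)
Definition marginal_kernel (n : nat) (s : T) : \bar R :=
  if (b < p)%R then
    \int[m]_u ((\int[m]_r Lpow n u r) `^ (p / b - 1)%R * Lpow n u s)
  else \int[m]_u Lpow n u s.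

Let b0 : (0 < b)%R. Proof. exact: lt_le_trans b1. Qed.
Let p1 : (1 <= p)%R. Proof. exact: le_trans bp. Qed.
Let p0 : (0 < p)%R. Proof. exact: lt_le_trans p1. Qed.
Let pV0 : (0 <= p^-1)%R. Proof. by rewrite invr_ge0 ltW. Qed.
Let bV0 : (0 <= b^-1)%R. Proof. by rewrite invr_ge0 ltW. Qed.
Let pb1 : (1 <= p / b)%R. Proof. by rewrite ler_pdivlMr// mul1r. Qed.
Let pb0 : (0 <= p / b)%R. Proof. exact: le_trans pb1. Qed.
Let Lpow0 n u s : 0 <= Lpow n u s. Proof. exact: kernel_pow_ge0. Qed.
Let mLpow n : jointly_measurable (Lpow n). Proof. exact: measurable_kernel_pow. Qed.
Let Lop0 n f u : 0 <= Lop n f u.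
Proof. by apply: kernel_op_ge0 => // s; exact: poweR_ge0. Qed.

Let mLop n f : measurable_fun setT f -> measurable_fun setT (Lop n f).
Proof.
move=> mf; apply: measurable_kernel_op => //; first exact: measurable_fun_poweR.
by move=> s; exact: poweR_ge0.
Qed.

Let int_poweR_ge0 f r : 0 <= \int[m]_u (f u `^ r).
Proof. by apply: integral_ge0 => u _; exact: poweR_ge0. Qed.

Lemma ae_eq_iter_Lnorm j f g :
  measurable_fun setT f -> measurable_fun setT g ->
  (\forall u \ae m, f u = g u) -> iter_Lnorm j f = iter_Lnorm j g.
Proof.
move=> mf mg fg; case: j => [|j]; congr (_ `^ _).
  apply: ge0_ae_eq_integral => //.
  - exact: measurable_fun_poweR.
  - exact: measurable_fun_poweR.
  - by move=> u _; exact: poweR_ge0.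
  - by move=> u _; exact: poweR_ge0.
  - by apply: filterS fg => u -> _.
apply: eq_integral => u _; congr (_ `^ _); apply: ge0_ae_eq_integral => //.
- by apply: emeasurable_funM; [exact: measurable_kernelr|exact: measurable_fun_poweR].
- by apply: emeasurable_funM; [exact: measurable_kernelr|exact: measurable_fun_poweR].
- by move=> s _; rewrite mule_ge0 ?poweR_ge0.
- by move=> s _; rewrite mule_ge0 ?poweR_ge0.
- by apply: filterS fg => s -> _.
Qed.

(** Every iterate sees its argument only through integrals against [m], so an almost everywhere
    inequality suffices, as given by a recursion valid on [J]. *)
Lemma ae_le_iter_Lnorm j f g :
  measurable_fun setT f -> (forall u, 0 <= f u) ->
  measurable_fun setT g -> (forall u, 0 <= g u) ->
  (\forall u \ae m, f u <= g u) -> iter_Lnorm j f <= iter_Lnorm j g.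
Proof.
move=> mf f0 mg g0 fg; case: j => [|j]; apply: ge0_le_poweR => //.
  apply: ae_ge0_le_integral => //.
  - by move=> u _; exact: poweR_ge0.
  - exact: measurable_fun_poweR.
  - by move=> u _; exact: poweR_ge0.
  - exact: measurable_fun_poweR.
  - by apply: filterS fg => u fgu _; apply: ge0_le_poweR => //; exact: ltW.
apply: ge0_le_integral => //.
- by move=> u _; exact: poweR_ge0.
- by apply: measurable_fun_poweR; exact: mLop.
- by apply: measurable_fun_poweR; exact: mLop.
move=> u _; apply: ge0_le_poweR => //.
apply: ae_ge0_le_integral => //.
- by move=> s _; rewrite mule_ge0 ?poweR_ge0.
- by apply: emeasurable_funM; [exact: measurable_kernelr|exact: measurable_fun_poweR].
- by move=> s _; rewrite mule_ge0 ?poweR_ge0.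
- by apply: emeasurable_funM; [exact: measurable_kernelr|exact: measurable_fun_poweR].
- apply: filterS fg => s fgs _; apply: lee_wpmul2l => //.
  by apply: ge0_le_poweR => //; exact: ltW.
Qed.

(** Minkowski is used twice: in L^b against the kernel for each fixed [u], then in L^p(m). For
    [j = 0] the second use alone suffices. *)
Lemma iter_Lnorm_minkowski j f g :
  measurable_fun setT f -> (forall u, 0 <= f u) ->
  measurable_fun setT g -> (forall u, 0 <= g u) ->
  iter_Lnorm j (fun u => f u + g u) <= iter_Lnorm j f + iter_Lnorm j g.
Proof.
move=> mf f0 mg g0; case: j => [|j]; first exact: ge0_minkowski.
(* Writing [p / b] as [b^-1] times [p] exhibits the p-th power of the L^p-norm of a b-th root. *)
have E h : \int[m]_u (Lop j h u `^ (p / b)) = \int[m]_u ((Lop j h u `^ b^-1) `^ p).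
  by apply: eq_integral => u _; rewrite -poweRrM mulrC.
rewrite /iter_Lnorm !E.
have mLb h : measurable_fun setT h -> measurable_fun setT (fun u => Lop j h u `^ b^-1).
  by move=> mh; apply: measurable_fun_poweR; exact: mLop.
apply: le_trans (ge0_minkowski m p1 (mLb f mf) _ (mLb g mg) _).
- apply: ge0_le_poweR => //; apply: ge0_le_integral => //.
  + by move=> u _; exact: poweR_ge0.
  + by apply: measurable_fun_poweR; apply: mLb; exact: emeasurable_funD.
  + by apply: measurable_fun_poweR; apply: emeasurable_funD; exact: mLb.
  + move=> u _; apply: ge0_le_poweR => //; [exact: ltW|exact: poweR_ge0|].
    exact: kernel_op_minkowski.
- by move=> u; exact: poweR_ge0.
- by move=> u; exact: poweR_ge0.
Qed.

(** The b-th root taken after one application is undone by the power [b] before the next, so the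
    nonlinear iterates are roots of powers of a linear operator. *)
Lemma iter_Lnorm_kernel_op j f :
  measurable_fun setT f -> (forall u, 0 <= f u) ->
  iter_Lnorm j (fun u => Lop 0 f u `^ b^-1) = iter_Lnorm j.+1 f.
Proof.
move=> mf f0; case: j => [|j]; congr (_ `^ _); apply: eq_integral => u _.
  by rewrite -poweRrM mulrC.
rewrite {3}/Lop /Lpow kernel_op_powSr//; last 2 first.
- exact: measurable_fun_poweR.
- by move=> s; exact: poweR_ge0.
congr (_ `^ _); apply: eq_integral => s _.
by rewrite poweRVK ?gt_eqF.
Qed.

Let mweight n : measurable_fun setT (fun u => (\int[m]_r Lpow n u r) `^ (p / b - 1)%R).
Proof.
apply: measurable_fun_poweR.
by apply: (measurable_fun_fubini_tonelli_F (fun z => Lpow n z.1 z.2)) => //; exact: mLpow.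
Qed.

(** The two cases of the definition merge: for [b = p] the weight has exponent [0] and equals [1],
    even where its base is [0] or [+oo]. *)
Let marginal_kernelE n : marginal_kernel n =
  fun s => \int[m]_u ((\int[m]_r Lpow n u r) `^ (p / b - 1)%R * Lpow n u s).
Proof.
apply/funext => s; rewrite /marginal_kernel; case: ltP => // pb.
have -> : p = b by apply/eqP; rewrite eq_le bp pb.
rewrite divff ?gt_eqF// subrr; apply: eq_integral => u _.
by rewrite poweRe0 mul1e.
Qed.

Lemma measurable_marginal_kernel n : measurable_fun setT (marginal_kernel n).
Proof.
rewrite marginal_kernelE.
apply: (measurable_fun_fubini_tonelli_G
  (fun z : T * T => (\int[m]_r Lpow n z.1 r) `^ (p / b - 1)%R * Lpow n z.1 z.2)).
  apply: emeasurable_funM; last exact: mLpow.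
  exact: (measurableT_comp (mweight n) measurable_fst).
by move=> z; rewrite mule_ge0 ?poweR_ge0.
Qed.

Lemma marginal_kernel_ge0 n s : 0 <= marginal_kernel n s.
Proof.
by rewrite marginal_kernelE; apply: integral_ge0 => u _; rewrite mule_ge0 ?poweR_ge0.
Qed.

(** Weighted Jensen with exponent [p / b], for each fixed [u], moves the power inside the integral
    at the cost of the total kernel mass to the power [p / b - 1]; Tonelli then integrates [u]
    out. *)
Lemma iter_Lnorm_marginal_le n f :
  measurable_fun setT f -> (forall u, 0 <= f u) ->
  iter_Lnorm n.+1 f <= (\int[m]_s (marginal_kernel n s * f s `^ p)) `^ p^-1.
Proof.
move=> mf f0; apply: ge0_le_poweR => //.
have mfp : measurable_fun setT (fun s => f s `^ p) by exact: measurable_fun_poweR.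
rewrite marginal_kernelE -(@integral_kernel_op _ _ _ m (Lpow n)) //; last 2 first.
- by move=> u; exact: poweR_ge0.
- by move=> u; exact: poweR_ge0.
apply: ge0_le_integral => //.
- by move=> u _; exact: poweR_ge0.
- by apply: measurable_fun_poweR; exact: mLop.
- apply: emeasurable_funM => //; apply: measurable_kernel_op => //.
  by move=> s; exact: poweR_ge0.
move=> u _.
have := ge0_weighted_jensen m pb1 (measurable_kernelr u (mLpow n)) (Lpow0 n u)
  (measurable_fun_poweR b mf) (fun s => poweR_ge0 _ _).
under [X in _ <= _ * X]eq_integral do rewrite -poweRrM [(b * _)%R]mulrC divfK ?gt_eqF//.
exact.
Qed.

Section recursion.
Variables (x : nat -> T -> \bar R) (v : T -> \bar R).
Hypothesis mx : forall n, measurable_fun setT (x n).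
Hypothesis x0 : forall n u, 0 <= x n u.
Hypothesis mv : measurable_fun setT v.
Hypothesis v0 : forall u, 0 <= v u.

Let rec n u := v u + kernel_op m L (fun s => x n s `^ b) u `^ b^-1.

Let mrec1 n : measurable_fun setT (fun u => Lop 0 (x n) u `^ b^-1).
Proof. by apply: measurable_fun_poweR; exact: mLop. Qed.

Let mrec n : measurable_fun setT (rec n).
Proof. by apply: emeasurable_funD => //; exact: mrec1. Qed.

Let rec0 n u : 0 <= rec n u.
Proof. by rewrite adde_ge0// poweR_ge0. Qed.

Theorem iterated_Lnorm_le n : (0 < n)%N ->
  (forall i, \forall u \ae m, x i.+1 u <= rec i u) ->
  (\int[m]_u (x n u `^ p)) `^ p^-1 <=
  (\int[m]_u (v u `^ p)) `^ p^-1
  + \sum_(1 <= i < n) (\int[m]_s (marginal_kernel i.-1 s * v s `^ p)) `^ p^-1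
  + (\int[m]_s (marginal_kernel n.-1 s * x 0%N s `^ p)) `^ p^-1.
Proof.
move=> n0 hx.
have step i j : iter_Lnorm j (x i.+1) <= iter_Lnorm j v + iter_Lnorm j.+1 (x i).
  rewrite -iter_Lnorm_kernel_op//.
  apply: (le_trans (ae_le_iter_Lnorm j (mx _) (x0 _) (mrec i) (rec0 i) (hx i))).
  exact: (iter_Lnorm_minkowski j mv v0 (mrec1 i) (fun u => poweR_ge0 _ _)).
(* [j] counts the unrolled steps: each one lowers the index of [x] and adds one kernel
   application. *)
have H j : (j <= n)%N ->
    iter_Lnorm 0 (x n) <= \sum_(0 <= i < j) iter_Lnorm i v + iter_Lnorm j (x (n - j)%N).
  elim: j => [_|j IH jn]; first by rewrite big_geq// add0e subn0.
  apply: (le_trans (IH (ltnW jn))); rewrite big_nat_recr//= -addeA leeD2l//.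
  by rewrite -(subnSK jn).
(* At [j = n] only [x 0] is left. The term [i = 0], the norm of [v] without any kernel, is split off
   from the sum. *)
have := H n (leqnn n); rewrite subnn big_ltn//; move/le_trans; apply.
(* [iter_Lnorm i.+1] is bounded through [marginal_kernel i], hence the predecessors in the
   statement. *)
case: n n0 {H} => // n _; apply: leeD; last exact: iter_Lnorm_marginal_le.
rewrite leeD2l// !big_nat; apply: lee_sum => -[//|i] _.
exact: iter_Lnorm_marginal_le.
Qed.

Hypothesis bp_eq1 : b = 1%R /\ p = 1%R.

(** All exponents are [1], so the norms are plain iterated integrals and additivity takes the place
    of Minkowski. *)
Let iter_LnormD j f g :
  measurable_fun setT f -> (forall u, 0 <= f u) ->
  measurable_fun setT g -> (forall u, 0 <= g u) ->
  iter_Lnorm j (fun u => f u + g u) = iter_Lnorm j f + iter_Lnorm j g.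
Proof.
case: bp_eq1 => bE pE mf f0 mg g0.
have fg0 u : 0 <= f u + g u by exact: adde_ge0.
have E (h : T -> \bar R) : (forall u, 0 <= h u) ->
    iter_Lnorm j h = if j is i.+1 then \int[m]_u kernel_op m (Lpow i) h u
                     else \int[m]_u h u.
  move=> h0; rewrite /iter_Lnorm pE invr1; case: j => [|j].
  - by rewrite poweRe1 ?int_poweR_ge0//; apply: eq_integral => u _; rewrite poweRe1.
  - rewrite poweRe1 ?int_poweR_ge0//; apply: eq_integral => u _.
    rewrite bE divr1 poweRe1//.
    by apply: eq_integral => s _; rewrite bE poweRe1.
rewrite !E//; case: j {E} => [|j]; first exact: ge0_integralD.
rewrite -ge0_integralD//.
- apply: eq_integral => u _; rewrite -ge0_integralD//.
  + by apply: eq_integral => s _; rewrite ge0_muleDr.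
  + by move=> s _; exact: mule_ge0.
  + by apply: emeasurable_funM => //; exact: measurable_kernelr.
  + by move=> s _; exact: mule_ge0.
  + by apply: emeasurable_funM => //; exact: measurable_kernelr.
- by move=> u _; exact: kernel_op_ge0.
- exact: measurable_kernel_op.
- by move=> u _; exact: kernel_op_ge0.
- exact: measurable_kernel_op.
Qed.

(** Jensen has exponent [1] and the weight exponent [0], which leaves only the identity of
    Tonelli. *)
Let iter_Lnorm_marginal n f :
  measurable_fun setT f -> (forall u, 0 <= f u) ->
  iter_Lnorm n.+1 f = (\int[m]_s (marginal_kernel n s * f s `^ p)) `^ p^-1.
Proof.
case: bp_eq1 => bE pE mf f0; congr (_ `^ _).
have mfp : measurable_fun setT (fun s => f s `^ p) by exact: measurable_fun_poweR.
rewrite marginal_kernelE -(@integral_kernel_op _ _ _ m (Lpow n)) //; last 2 first.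
- by move=> u; exact: poweR_ge0.
- by move=> u; exact: poweR_ge0.
apply: eq_integral => u _; rewrite /Lop bE pE divr1 subrr poweRe0 mul1e poweRe1//.
by apply: kernel_op_ge0 => // s; exact: poweR_ge0.
Qed.

(** The unrolling is that of the inequality; its two lossy steps, Minkowski and Jensen, are now
    identities. *)
Theorem iterated_Lnorm_eq n : (0 < n)%N ->
  (forall i, \forall u \ae m, x i.+1 u = rec i u) ->
  (\int[m]_u (x n u `^ p)) `^ p^-1 =
  (\int[m]_u (v u `^ p)) `^ p^-1
  + \sum_(1 <= i < n) (\int[m]_s (marginal_kernel i.-1 s * v s `^ p)) `^ p^-1
  + (\int[m]_s (marginal_kernel n.-1 s * x 0%N s `^ p)) `^ p^-1.
Proof.
move=> n0 hx.
have step i j : iter_Lnorm j (x i.+1) = iter_Lnorm j v + iter_Lnorm j.+1 (x i).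
  rewrite -iter_Lnorm_kernel_op// (ae_eq_iter_Lnorm j (mx _) (mrec i) (hx i)).
  exact: (iter_LnormD j mv v0 (mrec1 i) (fun u => poweR_ge0 _ _)).
have H j : (j <= n)%N ->
    iter_Lnorm 0 (x n) = \sum_(0 <= i < j) iter_Lnorm i v + iter_Lnorm j (x (n - j)%N).
  elim: j => [_|j IH jn]; first by rewrite big_geq// add0e subn0.
  by rewrite (IH (ltnW jn)) big_nat_recr//= -addeA -(subnSK jn) step.
transitivity (iter_Lnorm 0 (x n)) => //.
rewrite (H n (leqnn n)) subnn big_ltn//.
case: n n0 {H} => // n _; rewrite -iter_Lnorm_marginal//; congr (_ + _ + _).
rewrite !big_nat; apply: eq_bigr => -[//|i] _.
exact: iter_Lnorm_marginal.
Qed.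

End recursion.

End iterated_inequality.

(** * Restriction of a measure to a measurable set *)

Section restricted_measure.
Context d (T : measurableType d) (R : realType).
Variables (mu : {measure set T -> \bar R}) (D : set T).
Hypothesis mD : measurable D.

(** Tonelli is applied on the whole space, while [mu] is sigma-finite on [I] only. Adding the
    complement of [D] to each covering set yields a cover of everything without raising the masses,
    as the restriction does not charge that complement. *)
Lemma sigma_finite_restriction (I : set T) : D `<=` I -> sigma_finite I mu ->
  exists m : {sigma_finite_measure set T -> \bar R}, forall A, m A = mu (A `&` D).
Proof.
move=> DI [F IF mF].
have sf : sigma_finite setT (mrestr mu mD).
  exists (fun i => F i `|` ~` D).
    apply/esym/seteqP; split=> // x _; have [/DI|nDx] := pselect (D x).
      by rewrite IF => -[i _ Fx]; exists i => //; left.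
    by exists 0%N => //; right.
  move=> i; split; first by apply: measurableU; [exact: (mF i).1|exact: measurableC].
  rewrite /mrestr setIUl setICl setU0; apply: le_lt_trans (mF i).2.
  by apply: le_measure; rewrite ?inE; [apply: measurableI => //| |exact: subIsetl];
    exact: (mF i).1.
pose m : {sigma_finite_measure set T -> \bar R} :=
  HB.pack (mrestr mu mD) (Measure_isSigmaFinite.Build _ _ _ (mrestr mu mD) sf).
by exists m.
Qed.

Variable m : {measure set T -> \bar R}.
Hypothesis mE : forall A, m A = mu (A `&` D).

(** Translates whole-space integrals into integrals over intervals: values of [F] outside [D] do not
    count for [m], and on [D] outside [B] they vanish. *)
Lemma integral_restriction (B : set T) (F G : T -> \bar R) :
  measurable B -> B `<=` D ->
  measurable_fun setT F -> (forall x, 0 <= F x) ->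
  (forall x, B x -> F x = G x) -> (forall x, D x -> ~ B x -> F x = 0) ->
  \int[m]_x F x = \int[mu]_(x in B) G x.
Proof.
move=> mB BD mF F0 FG F00.
rewrite (@ge0_negligible_integral _ _ _ _ _ (~` D))//; last 2 first.
- exact: measurableC.
- by rewrite mE setICl measure0.
rewrite setTD setCK (@eq_measure_integral _ _ _ _ mu); last first.
  by move=> A _ AD; rewrite mE setIidl.
transitivity (\int[mu]_(x in D) (F \_ B) x).
  apply: eq_integral => x /set_mem Dx; rewrite patchE.
  by case: ifPn => // /negP xB; rewrite F00// => Bx; apply: xB; rewrite inE.
rewrite -integral_mkcondr setIidr//.
by apply: eq_integral => x /set_mem; exact: FG.
Qed.

Lemma ae_restriction (J : set T) : mu.-negligible (D `\` J) ->
  \forall x \ae m, D x /\ J x.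
Proof.
move=> [N [mN N0 sub]]; exists (N `|` ~` D); split.
- by apply: measurableU => //; exact: measurableC.
- rewrite mE setIUl setICl setU0; apply/eqP; rewrite eq_le measure_ge0 andbT -N0.
  by apply: le_measure; rewrite ?inE//; exact: measurableI.
- move=> x /= /not_andP nDJ; have [Dx|] := pselect (D x); last by right.
  by left; apply: sub; split=> //; case: nDJ.
Qed.

End restricted_measure.

(** * Extension of kernels and processes by zero *)

Section zero_extension.
Context (R : realType).
Variable D : set R.
Hypothesis mD : measurable D.

Lemma measurable_triangle : measurable (triangle D).
Proof.
rewrite (_ : triangle D = (D `*` D) `&` [set z | (z.2 <= z.1)%R]); last first.
  by apply/seteqP; split=> z /=; [move=> [? [? ?]]|move=> [[? ?] ?]].
apply: measurableI; first exact: measurableX.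
rewrite -[X in measurable X]setTI.
exact: (measurable_fun_ler measurable_snd measurable_fst measurableT).
Qed.

(** The variable limits of Volterra integrals become a support condition, so that kernels can be
    composed by integrating over the whole space. *)
Definition kernel_extension (k : R -> R -> \bar R) (u s : R) : \bar R :=
  ((fun z => k z.1 z.2) \_ (triangle D)) (u, s).

Lemma kernel_extension_in k u s : triangle D (u, s) -> kernel_extension k u s = k u s.
Proof. by move=> H; rewrite /kernel_extension patchE mem_set. Qed.

Lemma kernel_extension_out k u s : ~ triangle D (u, s) -> kernel_extension k u s = 0.
Proof. by move=> H; rewrite /kernel_extension patchE memNset. Qed.

Lemma kernel_extension_ge0 (k : R -> R -> \bar R) u s : nonneg_kernel D k ->
  0 <= kernel_extension k u s.
Proof.
move=> [_ k0]; have [tus|tus] := pselect (triangle D (u, s)).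
  by rewrite kernel_extension_in// k0.
by rewrite kernel_extension_out.
Qed.

Lemma measurable_kernel_extension k : nonneg_kernel D k ->
  jointly_measurable (kernel_extension k).
Proof.
move=> [mk _].
have /(measurable_restrictT _ measurable_triangle) := mk.
by congr (measurable_fun _ _); apply/funext => -[].
Qed.

Lemma nonneg_kernelS (I : set R) k : D `<=` I -> measurable (triangle I) ->
  nonneg_kernel I k -> nonneg_kernel D k.
Proof.
move=> DI mI [mk k0].
have sub : triangle D `<=` triangle I by move=> z [? [? ?]]; split; [|split]; auto.
by split; [exact: measurable_funS mk|move=> t s /sub; exact: k0].
Qed.

Lemma nonneg_kernel_poweR k (b : R) : nonneg_kernel D k ->
  nonneg_kernel D (fun u s => k u s `^ b).
Proof.
by move=> [mk k0]; split; [exact: measurable_fun_poweR|move=> *; exact: poweR_ge0].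
Qed.

(** Outside [I] the values of [X] are arbitrary. Extended by zero off [D], the process is product
    measurable on the whole line, and Tonelli makes its norms measurable in time. *)
Lemma moment_extension d (Omega : measurableType d) (P : probability Omega R)
    (I : set R) (X : R -> Omega -> \bar R) (p : R) :
  D `<=` I -> measurable I -> nonneg_process I X ->
  exists x : R -> \bar R, [/\ measurable_fun setT x, (forall u, 0 <= x u) &
    forall u, D u -> x u = moment P p (X u) `^ p^-1].
Proof.
move=> DI mI [mX X0].
pose X' := (fun z => X z.1 z.2) \_ (D `*` [set: Omega]).
have mX' : measurable_fun setT X'.
  apply/(measurable_restrictT _ _).1; first exact: measurableX.
  apply: measurable_funS mX; first exact: measurableX.
  by move=> z [/DI].
exists (fun u => (\int[P]_w (X' (u, w) `^ p)) `^ p^-1); split.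
- apply: measurable_fun_poweR.
  apply: (measurable_fun_fubini_tonelli_F (fun z => X' z `^ p)).
    exact: measurable_fun_poweR.
  by move=> z; exact: poweR_ge0.
- by move=> u; exact: poweR_ge0.
- move=> u Du; congr (_ `^ _); apply: eq_integral => w _.
  by rewrite /X' patchE mem_set.
Qed.

End zero_extension.

(** * Iterated Volterra kernels on the interval [0, t] *)

Section volterra_restriction.
Context (R : realType).
Variables (mu : {measure set R -> \bar R}) (t : R).
Let D : set R := `[0%R, t]%classic.
Variable m : {sigma_finite_measure set R -> \bar R}.
Hypothesis mE : forall A, m A = mu (A `&` D).
Variable k : R -> R -> \bar R.
Hypothesis hk : nonneg_kernel D k.

Let L := kernel_extension D k.
Let mD : measurable D. Proof. exact: measurable_itv. Qed.
Let mL : jointly_measurable L. Proof. exact: measurable_kernel_extension. Qed.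
Let L0 u s : 0 <= L u s. Proof. exact: kernel_extension_ge0. Qed.
Let Lpow0 n u s : 0 <= kernel_pow m L n u s. Proof. exact: kernel_pow_ge0. Qed.
Let mLpow n : jointly_measurable (kernel_pow m L n).
Proof. exact: measurable_kernel_pow. Qed.

Let DE u : D u <-> (0 <= u <= t)%R.
Proof. by rewrite /D /= in_itv. Qed.

Let triangleE u s : triangle D (u, s) <-> (0 <= s <= u)%R /\ (u <= t)%R.
Proof.
rewrite /triangle /= !DE; split.
  by move=> [/andP[_ ut] [/andP[s0 _] su]]; rewrite s0 su ut.
move=> [/andP[s0 su] ut]; rewrite s0 ut su (le_trans s0 su) (le_trans su ut).
by [].
Qed.

Let subitvD a u : (0 <= a)%R -> D u -> `[a, u] `<=` D.
Proof.
move=> a0 /DE /andP[_ ut] x /=; rewrite in_itv/= => /andP[ax xu].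
by apply/DE; rewrite (le_trans a0 ax) (le_trans xu ut).
Qed.

(** Triangular support survives composition, since [s <= w] and [w <= u] give [s <= u]. *)
Lemma kernel_pow_extension_out n u s : ~ triangle D (u, s) -> kernel_pow m L n u s = 0.
Proof.
elim: n u s => [|n IH] u s us; first exact: kernel_extension_out.
rewrite /= integral0_eq// => w _.
have [uw|uw] := pselect (triangle D (u, w)); last first.
  by rewrite /L kernel_extension_out// mul0e.
rewrite IH ?mule0// => ws; apply: us; move: uw ws.
rewrite !triangleE => -[/andP[w0 wu] ut] [/andP[s0 sw] _].
by rewrite s0 (le_trans sw wu).
Qed.

(** The composed integrand vanishes unless [s <= w <= u], so the whole-space integral against [m] is
    the one over [[s, u]] against [mu]. *)
Lemma kernel_pow_extension_in n u s :
  triangle D (u, s) -> kernel_pow m L n u s = iter_kernel mu k n.+1 u s.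
Proof.
elim: n u s => [|n IH] u s us; first exact: kernel_extension_in.
have [Du [Ds su]] := us; move/triangleE : (us) => [/andP[s0 _] ut].
rewrite /=; apply: (integral_restriction mD mE).
- exact: measurable_itv.
- exact: subitvD.
- by apply: emeasurable_funM; [exact: measurable_kernelr|exact: measurable_kernell].
- by move=> w; exact: mule_ge0.
- move=> w /=; rewrite in_itv/= => /andP[sw wu].
  rewrite /L kernel_extension_in ?IH//; apply/triangleE.
    by rewrite s0 sw (le_trans wu ut).
  by rewrite (le_trans s0 sw) wu ut.
- move=> w Dw /=; rewrite in_itv/= => wsu.
  have [uw|uw] := pselect (triangle D (u, w)); last first.
    by rewrite /L kernel_extension_out// mul0e.
  rewrite kernel_pow_extension_out ?mule0// => /triangleE[/andP[_ sw] _].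
  by apply: wsu; move/triangleE : uw => [/andP[_ wu] _]; rewrite sw wu.
Qed.

(** Serves the recursion and the [k]-part of [v], both with [n = 0], and the weight inside
    [power_kernel]. *)
Lemma integral_kernel_section n u (f g : R -> \bar R) : D u ->
  measurable_fun setT f -> (forall s, 0 <= f s) -> (forall s, D s -> f s = g s) ->
  \int[m]_s (kernel_pow m L n u s * f s) =
  \int[mu]_(s in `[0%R, u]) (iter_kernel mu k n.+1 u s * g s).
Proof.
move=> Du mf f0 fg; have sub := subitvD (lexx 0%R) Du.
apply: (integral_restriction mD mE) => //.
- by apply: emeasurable_funM => //; exact: measurable_kernelr.
- by move=> s; exact: mule_ge0.
- move=> s su; rewrite fg ?kernel_pow_extension_in//; last exact: sub.
  apply/triangleE; move: su; rewrite /= in_itv/= => ->.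
  by move/DE : Du => /andP[].
- move=> s Ds su; rewrite kernel_pow_extension_out ?mul0e// => /triangleE[s0u _].
  by apply: su; rewrite /= in_itv.
Qed.

End volterra_restriction.

(** The integration range is cut on both sides: above [t] by the measure [m], below [s] by the
    triangular support. *)
Lemma marginal_kernel_restriction (R : realType) (mu : {measure set R -> \bar R}) (t : R)
    (m : {sigma_finite_measure set R -> \bar R})
    (l : R -> R -> \bar R) (p b : R) (n : nat) (s : R) :
  (forall A, m A = mu (A `&` `[0%R, t])) -> nonneg_kernel `[0%R, t] l -> (0 <= s <= t)%R ->
  marginal_kernel m (kernel_extension `[0%R, t] (fun u r => l u r `^ b)) p b n s =
  power_kernel mu l n.+1 b p t s.
Proof.
move=> mE hl /andP[s0 st]; have hlb := nonneg_kernel_poweR b hl.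
set D : set R := `[0%R, t]%classic in mE hl hlb *.
have mD : measurable D by exact: measurable_itv.
have Ds : D s by rewrite /D/= in_itv/= s0.
have Kin u r := @kernel_pow_extension_in _ _ _ _ mE _ hlb n u r.
have K0 u r : 0 <= kernel_pow m (kernel_extension D (fun u r => l u r `^ b)) n u r.
  by apply: kernel_pow_ge0 => *; exact: kernel_extension_ge0.
have mK : jointly_measurable (kernel_pow m (kernel_extension D (fun u r => l u r `^ b)) n).
  apply: measurable_kernel_pow; first exact: measurable_kernel_extension.
  by move=> *; exact: kernel_extension_ge0.
have sub : `[s, t] `<=` D.
  by move=> x; rewrite /D/= !in_itv/= => /andP[sx ->]; rewrite (le_trans s0 sx).
have tri u : `[s, t]%classic u -> triangle D (u, s).
  by move=> su; split; [exact: sub|split=> //]; move: su; rewrite /= in_itv/= => /andP[].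
have out u : D u -> ~ `[s, t]%classic u ->
    kernel_pow m (kernel_extension D (fun u r => l u r `^ b)) n u s = 0.
  move=> Du su; apply: kernel_pow_extension_out => -[_ [_ /= us]]; apply: su.
  by move: Du; rewrite /D/= !in_itv/= us => /andP[].
rewrite /marginal_kernel /power_kernel; case: ifPn => _.
- apply: (integral_restriction mD mE) => //.
  + apply: emeasurable_funM; last exact: measurable_kernell.
    apply: measurable_fun_poweR.
    by apply: (measurable_fun_fubini_tonelli_F (fun z =>
      kernel_pow m (kernel_extension D (fun u r => l u r `^ b)) n z.1 z.2)).
  + by move=> u; rewrite mule_ge0 ?poweR_ge0.
  + move=> u su; rewrite Kin; last exact: tri.
    congr (_ `^ _ * _).
    (* Integrating the constant [1] gives the total kernel mass in the weight. *)
    have := integral_kernel_section mE hlb n (sub _ su)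
      (f := cst 1) (g := cst 1) (measurable_cst _) (fun=> lee01) (fun _ _ => erefl).
    under eq_integral do rewrite mule1.
    by under [RHS]eq_integral do rewrite mule1.
  + by move=> u Du su; rewrite out ?mule0.
- apply: (integral_restriction mD mE) => //.
  + exact: measurable_kernell.
  + by move=> u su; rewrite Kin//; exact: tri.
Qed.

(** * From the processes to their moment norms on [0, t] *)

Theorem corollary3p18 (R : realType) (d : measure_display)
  (Omega : measurableType d) (P : probability Omega R)
  (I : set R) (hI : is_interval I) (hI0 : I 0%R)
  (hIpos : forall t, I t -> (0 <= t)%R)
  (hInd : exists2 t, I t & (0 < t)%R)
  (mu : {measure set R -> \bar R})
  (hmu : sigma_finite I mu)
  (J : set R) (hJI : J `<=` I) (hJ : mu.-negligible (I `\` J))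
  (p beta : R) (hp : (1 <= p)%R) (hbeta : (1 <= beta <= p)%R)
  (Y : R -> Omega -> \bar R) (hY : nonneg_process I Y)
  (k l : R -> R -> \bar R) (hk : nonneg_kernel I k) (hl : nonneg_kernel I l)
  (X : nat -> R -> Omega -> \bar R)
  (hX : forall n, nonneg_process I (X n))
  (hineq : forall (n : nat) (t : R), (0 < n)%N -> J t ->
    moment P p (X n t) `^ p^-1 <=
    vfun P mu k Y beta p t
    + (\int[mu]_(s in `[0%R, t])
         (l t s `^ beta * moment P p (X n.-1 s) `^ (beta / p)%R)) `^ beta^-1) :
  let v := vfun P mu k Y beta p in
  let lhs n t := (\int[mu]_(s in `[0%R, t]) moment P p (X n s)) `^ p^-1 in
  let rhs n t :=
    (\int[mu]_(s in `[0%R, t]) (v s `^ p)) `^ p^-1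
    + \sum_(1 <= i < n)
        (\int[mu]_(s in `[0%R, t]) (power_kernel mu l i beta p t s * v s `^ p)) `^ p^-1
    + (\int[mu]_(s in `[0%R, t])
         (power_kernel mu l n beta p t s * moment P p (X 0%N s))) `^ p^-1 in
  (forall (n : nat) (t : R), (0 < n)%N -> J t -> lhs n t <= rhs n t)
  /\ (beta = 1%R -> p = 1%R ->
      (forall (n : nat) (t : R), (0 < n)%N -> J t ->
         \int[P]_w X n t w =
         v t + \int[mu]_(s in `[0%R, t]) (l t s * \int[P]_w X n.-1 s w)) ->
      forall (n : nat) (t : R), (0 < n)%N -> J t -> lhs n t = rhs n t).
Proof.
move=> v lhs rhs.
have p0 : (0 < p)%R by rewrite (lt_le_trans _ hp).
case/andP: hbeta => b1 bp; have b0 : (0 < beta)%R by rewrite (lt_le_trans _ b1).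
have mI : measurable I by exact: is_interval_measurable.
have mTI : measurable (triangle I) by exact: measurable_triangle.
(* Both halves share this reduction for fixed [t]: [x n] is the p-th moment norm of [X n] and [v']
   agrees with [v], on [[0, t]], but both are measurable on the whole line; [L] extends [l^beta] by
   zero. *)
have main t : J t -> exists m : {sigma_finite_measure set R -> \bar R},
    exists L : R -> R -> \bar R, exists x : nat -> R -> \bar R, exists v' : R -> \bar R,
  [/\ [/\ jointly_measurable L, (forall u s, 0 <= L u s),
          (forall n, measurable_fun setT (x n)) & (forall n u, 0 <= x n u)],
      [/\ measurable_fun setT v', (forall u, 0 <= v' u) &
          \forall u \ae m, (0 <= u <= t)%R /\ J u],
      [/\ (forall n u, (0 <= u <= t)%R -> x n u = moment P p (X n u) `^ p^-1),
          (forall u, (0 <= u <= t)%R -> v' u = v u) &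
          (forall n u, (0 <= u <= t)%R -> kernel_op m L (fun s => x n s `^ beta) u =
            \int[mu]_(s in `[0%R, u])
              (l u s `^ beta * moment P p (X n s) `^ (beta / p)%R))] &
      forall n, (0 < n)%N ->
        lhs n t = (\int[m]_u (x n u `^ p)) `^ p^-1 /\
        rhs n t = (\int[m]_u (v' u `^ p)) `^ p^-1
  + \sum_(1 <= i < n) (\int[m]_s (marginal_kernel m L p beta i.-1 s * v' s `^ p)) `^ p^-1
  + (\int[m]_s (marginal_kernel m L p beta n.-1 s * x 0%N s `^ p)) `^ p^-1].
  move=> Jt; have It := hJI _ Jt; have t0 := hIpos _ It.
  pose D : set R := `[0%R, t]%classic.
  have DE u : D u <-> (0 <= u <= t)%R by rewrite /D/= in_itv.
  have mD : measurable D by exact: measurable_itv.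
  have DI : D `<=` I by move=> u /DE; exact: hI.
  have [m mE] := sigma_finite_restriction mD DI hmu.
  have hlD := nonneg_kernelS DI mTI hl.
  have hkD := nonneg_kernelS DI mTI hk.
  have hlb := nonneg_kernel_poweR beta hlD.
  have hkb := nonneg_kernel_poweR beta hkD.
  pose L := kernel_extension D (fun u s => l u s `^ beta).
  pose K := kernel_extension D (fun u s => k u s `^ beta).
  have mL : jointly_measurable L by exact: measurable_kernel_extension.
  have L0 u s : 0 <= L u s by exact: kernel_extension_ge0.
  have mK : jointly_measurable K by exact: measurable_kernel_extension.
  have K0 u s : 0 <= K u s by exact: kernel_extension_ge0.
  have [x hx] := choice (fun n => moment_extension mD P p DI mI (hX n)).
  have [y [my y0 yE]] := moment_extension mD P p DI mI hY.
  have mx n : measurable_fun setT (x n) by case: (hx n).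
  have x0 n u : 0 <= x n u by case: (hx n).
  have xE n u : (0 <= u <= t)%R -> x n u = moment P p (X n u) `^ p^-1.
    by move=> /DE Du; case: (hx n) => _ _; exact.
  (* The second summand of [v] is the operator with kernel [k^beta] applied to the constant [1],
     which makes [v'] measurable. *)
  pose v' u := y u + kernel_op m K (cst 1) u `^ beta^-1.
  have mv' : measurable_fun setT v'.
    apply: emeasurable_funD => //; apply: measurable_fun_poweR.
    exact: measurable_kernel_op.
  have v'0 u : 0 <= v' u by rewrite adde_ge0// poweR_ge0.
  have v'E u : (0 <= u <= t)%R -> v' u = v u.
    move=> /DE Du; rewrite /v' yE//; congr (_ + _ `^ _).
    rewrite /kernel_op (integral_kernel_section mE hkb 0 Du (g := cst 1))//.
    by under eq_integral do rewrite mule1.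
  have xpE n u : (0 <= u <= t)%R -> x n u `^ p = moment P p (X n u).
    move=> ut; rewrite xE// poweRVK ?gt_eqF//.
    by apply: integral_ge0 => w _; exact: poweR_ge0.
  have intD (F G : R -> \bar R) : measurable_fun setT F -> (forall u, 0 <= F u) ->
      (forall u, (0 <= u <= t)%R -> F u = G u) ->
      \int[m]_u F u = \int[mu]_(u in `[0%R, t]) G u.
    move=> mF F0 FG; apply: (integral_restriction mD mE) => // u /DE; exact: FG.
  have mM n : measurable_fun setT (marginal_kernel m L p beta n).
    exact: measurable_marginal_kernel.
  have M0 n s : 0 <= marginal_kernel m L p beta n s by exact: marginal_kernel_ge0.
  have mp (f : R -> \bar R) : measurable_fun setT f ->
    measurable_fun setT (fun u => f u `^ p) by exact: measurable_fun_poweR.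
  exists m, L, x, v'; split; [by split|split=> //|split=> //|].
  - have hDJ : mu.-negligible (D `\` J).
      by apply: negligibleS hJ => u [/DI Iu Ju]; split.
    by apply: filterS (ae_restriction mD mE hDJ) => u [/DE].
  - move=> n u /DE Du; rewrite /kernel_op (integral_kernel_section mE hlb 0 Du
      (g := fun s => moment P p (X n s) `^ (beta / p)%R))//.
    + exact: measurable_fun_poweR.
    + by move=> s; exact: poweR_ge0.
    + by move=> s /DE Ds; rewrite xE// -poweRrM mulrC.
  - move=> n n0; split.
      congr (_ `^ _); apply/esym/intD => [||u ut]; last by rewrite xpE.
        exact: mp.
      by move=> u; exact: poweR_ge0.
    congr (_ + _ + _).
    + congr (_ `^ _); apply/esym/intD => [||u ut]; last by rewrite v'E.
        exact: mp.
      by move=> u; exact: poweR_ge0.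
    + rewrite !big_nat; apply: eq_bigr => -[//|i] _.
      congr (_ `^ _); apply/esym/intD => [||s st]; last first.
          by rewrite v'E//= (marginal_kernel_restriction _ _ _ mE).
        by move=> u; rewrite mule_ge0 ?poweR_ge0.
      by apply: emeasurable_funM => //; exact: mp.
    + case: n n0 => // n _.
      congr (_ `^ _); apply/esym/intD => [||s st]; last first.
          by rewrite xpE//= (marginal_kernel_restriction _ _ _ mE).
        by move=> u; rewrite mule_ge0 ?poweR_ge0.
      by apply: emeasurable_funM => //; exact: mp.
split=> [n t n0 Jt|beta1 p1 heq n t n0 Jt].
  have [m [L [x [v' [[mL L0 mx x0] [mv v0 aeJ] [xE vE BE] /(_ n n0)[-> ->]]]]]] := main t Jt.
  (* The assumed inequality is available at times in [J], that is, at [m]-almost every time, and is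
     used with index [i.+1]. *)
  apply: iterated_Lnorm_le => // i; apply: filterS aeJ => u [ut Ju].
  by rewrite xE// vE// BE//; exact: (hineq i.+1 u).
have [m [L [x [v' [[mL L0 mx x0] [mv v0 aeJ] [xE vE BE] /(_ n n0)[-> ->]]]]]] := main t Jt.
apply: iterated_Lnorm_eq => // i; apply: filterS aeJ => u [ut Ju].
(* For [p = 1] the moment is the expectation; removing the exponent uses non-negativity of the
   process, hence a time in [I]. *)
have momE j s : I s -> moment P p (X j s) = \int[P]_w X j s w.
  move=> Is; apply: eq_integral => w _; rewrite p1 poweRe1//.
  exact: (hX j).2.
have int0 j s : I s -> 0 <= \int[P]_w X j s w.
  by move=> Is; apply: integral_ge0 => w _; exact: (hX j).2.
have Iu := hJI _ Ju.
have I0u s : (0 <= s <= u)%R -> I s by exact: hI.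
rewrite xE// vE// BE// momE//.
have -> : \int[mu]_(s in `[0%R, u]) (l u s `^ beta * moment P p (X i s) `^ (beta / p)) =
          \int[mu]_(s in `[0%R, u]) (l u s * \int[P]_w X i s w).
  apply: eq_integral => s /set_mem; rewrite /= in_itv/= => su.
  have l0 : 0 <= l u s.
    by apply: hl.2; split=> //=; split; [exact: I0u|case/andP: su].
  by rewrite momE ?beta1 ?p1 ?divr1 ?poweRe1 ?int0//; exact: I0u.
rewrite beta1 p1 invr1 !poweRe1 ?int0// ?heq//; apply: integral_ge0 => s.
rewrite /= in_itv/= => su; apply: mule_ge0; last by apply: int0; exact: I0u.
by apply: hl.2; split=> //=; split; [exact: I0u|case/andP: su].
Qed.
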